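(* Let $p$ be a prime number and $\mathbf c=(c_k)_{k\ge0}$ a bounded sequence of integers such that the $p$-adic number $\xi=c_0+c_1p+c_2p^2+\cdots$ is irrational. Then $$\mu^{\times}(\xi)=\frac{2}{1-\eta(\mathbf c)}\quad\text{and}\quad \widehat{\mu}^{\times}(\xi)=\frac{2}{1-\widehat\eta(\mathbf c)},$$ with the convention $2/0=+\infty$.
   Context: It is not assumed that $(c_k)$ is the Hensel expansion of $\xi$ (digits need not lie in $\{0,\dots,p-1\}$). For $m\ge1$ put $x_m=\frac{c_0}{p^m}+\frac{c_1}{p^{m-1}}+\dots+\frac{c_{m-1}}{p}$, and let $\eta_m$ be the real number such that the largest partial quotient (in the continued fraction expansion) of $x_m$ equals $p^{\eta_m m}$. Define $\eta(\mathbf c)=\limsup_{m\to\infty}\eta_m$ and $\widehat\eta(\mathbf c)=\liminf_{m\to\infty}\eta_m$. For an irrational $p$-adic number $\xi$, $\mu^{\times}(\xi)$ is the supremum of the real numbers $\mu$ for which $0<|b\xi-a|_p\le(|ab|^{1/2})^{-\mu}$ has infinitely many solutions in nonzero integers $a,b$; $\widehat{\mu}^{\times}(\xi)$ is the supremum of the real numbers $\widehat\mu$ for which the system $0<|ab|^{1/2}\le X$, $|b\xi-a|_p\le X^{-\widehat\mu}$ has a solution in integers $a,b$ for every sufficiently large real $X$. *)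

(* Defs.v *)
From HB Require Import structures.
From mathcomp Require Import all_boot all_order all_algebra ring_quotient.
From mathcomp Require Import all_classical all_reals all_analysis.
From mathcomp Require Import ring.
Set Implicit Arguments.
Unset Strict Implicit.
Unset Printing Implicit Defensive.
Import Order.TTheory GRing.Theory Num.Theory.
Import numFieldNormedType.Exports.
Local Open Scope classical_set_scope.
Local Open Scope ring_scope.

(* Only meaningful for x != 0. *)
Definition padic_val (p : nat) (x : rat) : int :=
  (logn p `|numq x|)%:Z - (logn p `|denq x|)%:Z.

(* For p not prime, [logn p] is identically 0, so [padic_norm p] is the trivial
   absolute value; this is what allows the constructions below to be carried
   out for every p : nat. *)
Definition padic_norm (p : nat) (x : rat) : rat :=
  if x == 0 then 0 else (p%:R : rat) ^ (- padic_val p x).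

Section PadicNorm.
Variable p : nat.
Local Notation N := (padic_norm p).

Lemma padic_normNprime x : ~~ prime p -> N x = (x != 0)%:R.
Proof.
move=> Np; rewrite /padic_norm /padic_val; case: eqP => //= _.
have l0 n : logn p n = 0%N by rewrite lognE (negPf Np).
by rewrite !l0 subrr oppr0 expr0z.
Qed.

Lemma padic_norm0 : N 0 = 0. Proof. by rewrite /padic_norm eqxx. Qed.

Lemma padic_norm_gt0 x : (0 < N x) = (x != 0).
Proof.
case: (boolP (prime p)) => [pp|/padic_normNprime ->]; last by case: eqP.
rewrite /padic_norm; case: eqP => [|_] /=; first by rewrite ltxx.
by rewrite exprz_gt0 // ltr0n prime_gt0.
Qed.

Lemma padic_norm_ge0 x : 0 <= N x.
Proof.
have [->|x0] := eqVneq x 0; first by rewrite padic_norm0.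
by rewrite ltW // padic_norm_gt0.
Qed.

Lemma padic_norm_eq0 x : (N x == 0) = (x == 0).
Proof. by have := padic_norm_gt0 x; rewrite lt0r padic_norm_ge0 andbT => /negb_inj. Qed.

Lemma padic_val_frac (a b : int) : a != 0 -> b != 0 ->
  padic_val p (a%:~R / b%:~R) = (logn p `|a|)%:Z - (logn p `|b|)%:Z.
Proof.
move=> a0 b0; rewrite /padic_val; set x := (_ / _).
have x0 : x != 0 by rewrite mulf_neq0 ?invr_eq0 ?intr_eq0.
have E : (numq x * b)%R = (a * denq x)%R.
  apply: (@intr_inj rat); rewrite !rmorphM /=.
  by apply/eqP; rewrite -eqr_div ?intr_eq0 ?denq_eq0 // divq_num_den.
have /(congr1 (fun z : int => logn p `|z|%N)) := E.
rewrite !abszM !lognM ?absz_gt0 ?numq_eq0 ?denq_eq0 // => /(congr1 Posz).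
rewrite !PoszD => E'; apply/eqP; rewrite subr_eq addrAC eq_sym subr_eq.
by rewrite E'.
Qed.

Lemma padic_norm_frac (a b : int) : a != 0 -> b != 0 ->
  N (a%:~R / b%:~R) = (p%:R : rat) ^ ((logn p `|b|)%:Z - (logn p `|a|)%:Z).
Proof.
move=> a0 b0; rewrite /padic_norm padic_val_frac // opprB ifF //.
by apply/negbTE; rewrite mulf_neq0 ?invr_eq0 ?intr_eq0.
Qed.

Lemma padic_norm1 : N 1 = 1.
Proof.
by have := @padic_norm_frac 1 1 isT isT; rewrite divr1 => ->; rewrite subrr expr0z.
Qed.

Lemma padic_normN x : N (- x) = N x.
Proof. by rewrite /padic_norm /padic_val oppr_eq0 numqN denqN abszN. Qed.

Lemma padic_normM x y : N (x * y) = N x * N y.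
Proof.
have [->|x0] := eqVneq x 0; first by rewrite mul0r padic_norm0 mul0r.
have [->|y0] := eqVneq y 0; first by rewrite mulr0 padic_norm0 mulr0.
case: (boolP (prime p)) => [pp|np]; last first.
  by rewrite !padic_normNprime // mulf_neq0 // x0 y0 mulr1.
have p0 : (p%:R : rat) != 0 by rewrite pnatr_eq0 -lt0n prime_gt0.
rewrite -[x]divq_num_den -[y]divq_num_den mulrACA -invfM -!rmorphM /=.
rewrite !padic_norm_frac ?mulf_neq0 ?numq_eq0 ?denq_eq0 // -expfzDr //.
rewrite !abszM !lognM ?absz_gt0 ?numq_eq0 ?denq_eq0 // !PoszD.
by rewrite opprD addrACA.
Qed.

Lemma padic_normV x : N x^-1 = (N x)^-1.
Proof.
have [->|x0] := eqVneq x 0; first by rewrite !(invr0, padic_norm0).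
apply: (@mulfI _ (N x)); first by rewrite padic_norm_eq0.
by rewrite -padic_normM !divff ?padic_norm_eq0 // padic_norm1.
Qed.

Lemma padic_normD x y : N (x + y) <= Num.max (N x) (N y).
Proof.
have [->|x0] := eqVneq x 0.
  by rewrite add0r padic_norm0 max_r // padic_norm_ge0.
have [->|y0] := eqVneq y 0.
  by rewrite addr0 padic_norm0 max_l // padic_norm_ge0.
have [->|xy0] := eqVneq (x + y) 0.
  by rewrite padic_norm0 le_max padic_norm_ge0.
case: (boolP (prime p)) => [pp|np]; last first.
  by rewrite !padic_normNprime // x0 y0 xy0 maxxx.
have p1 : 1 < (p%:R : rat) by rewrite ltr1n prime_gt1.
set b := denq x * denq y.
have b0 : b != 0 by rewrite mulf_neq0 ?denq_eq0.
have Ex : x = (numq x * denq y)%:~R / b%:~R.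
  by rewrite !rmorphM /= -mulf_div divff ?intr_eq0 ?denq_eq0 // mulr1 divq_num_den.
have Ey : y = (numq y * denq x)%:~R / b%:~R.
  rewrite /b [denq x * _]mulrC.
  by rewrite !rmorphM /= -mulf_div divff ?intr_eq0 ?denq_eq0 // mulr1 divq_num_den.
move: Ex Ey; set a := numq x * _; set c := numq y * _ => Ex Ey.
have a0 : a != 0 by rewrite mulf_neq0 ?denq_eq0 ?numq_eq0.
have c0 : c != 0 by rewrite mulf_neq0 ?denq_eq0 ?numq_eq0.
have Exy : x + y = (a + c)%:~R / b%:~R by rewrite rmorphD /= mulrDl -Ex -Ey.
have ac0 : a + c != 0.
  by apply: contraNneq xy0 => ac; rewrite Exy ac mul0r.
rewrite Exy Ex Ey !padic_norm_frac //.
rewrite le_max !ler_eXz2l // !lerD2l !lerN2 !lez_nat -geq_min.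
rewrite -pfactor_dvdn ?absz_gt0 //; set k := minn _ _.
suff: ((p ^ k)%N%:Z %| a + c)%Z by rewrite dvdzE absz_nat.
have dv z : z != 0 -> (k <= logn p `|z|)%N -> ((p ^ k)%N%:Z %| z)%Z.
  by move=> z0 kz; rewrite dvdzE absz_nat pfactor_dvdn ?absz_gt0.
by apply: rpredD; apply: dv => //; [exact: geq_minl|exact: geq_minr].
Qed.

End PadicNorm.

Definition padic_cauchy (p : nat) (u : nat -> rat) : Prop :=
  forall e : rat, 0 < e -> exists n0 : nat, forall m n,
    (n0 <= m)%N -> (n0 <= n)%N -> padic_norm p (u m - u n) < e.

Definition padic_null (p : nat) (u : nat -> rat) : Prop :=
  forall e : rat, 0 < e -> exists n0 : nat, forall n,
    (n0 <= n)%N -> padic_norm p (u n) < e.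

Definition cauchy_pred (p : nat) : {pred nat -> rat} :=
  [pred u | `[< padic_cauchy p u >]].

Section CauchyRing.
Variable p : nat.
Local Notation N := (padic_norm p).

Lemma padic_normB_lt x y e : N x < e -> N y < e -> N (x - y) < e.
Proof.
move=> xe ye; apply: le_lt_trans (padic_normD _ _ _) _.
by rewrite padic_normN gt_max xe ye.
Qed.

Lemma padic_cauchy_bounded u : padic_cauchy p u ->
  exists2 M : rat, 0 < M & exists n0 : nat, forall n, (n0 <= n)%N -> N (u n) <= M.
Proof.
move=> /(_ 1 ltr01) [n0 hu]; exists (Num.max (N (u n0)) 1).
  by rewrite lt_max ltr01 orbT.
exists n0 => n n0n; rewrite -[u n](subrK (u n0)).
apply: le_trans (padic_normD _ _ _) _.
by rewrite ge_max !le_max lexx /= (ltW (hu _ _ n0n (leqnn _))) orbT.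
Qed.

Lemma cauchy_subring : GRing.subring_closed (cauchy_pred p).
Proof.
split=> [|u v|u v].
- apply/asboolP => e e0; exists 0%N => m n _ _.
  by rewrite subrr padic_norm0.
- move=> /asboolP hu /asboolP hv; apply/asboolP => e e0.
  have [a ha] := hu _ e0; have [b hb] := hv _ e0.
  exists (maxn a b) => m n; rewrite !geq_max => /andP[am bm] /andP[an bn].
  have -> : (u - v) m - (u - v) n = (u m - u n) - (v m - v n).
    by have E k : (u - v) k = u k - v k by []; rewrite !E; ring.
  by rewrite padic_normB_lt ?ha ?hb.
- move=> /asboolP hu /asboolP hv; apply/asboolP => e e0.
  have [A A0 [a0 hA]] := padic_cauchy_bounded hu.
  have [B B0 [b0 hB]] := padic_cauchy_bounded hv.
  have [a ha] := hu _ (divr_gt0 e0 B0); have [b hb] := hv _ (divr_gt0 e0 A0).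
  exists (maxn (maxn a0 b0) (maxn a b)) => m n.
  rewrite !geq_max => /andP[/andP[a0m b0m] /andP[am bm]].
  move=> /andP[/andP[a0n b0n] /andP[an bn]].
  have -> : (u * v) m - (u * v) n = u m * (v m - v n) - (u n - u m) * v n.
    by have E k : (u * v) k = u k * v k by []; rewrite !E; ring.
  apply: padic_normB_lt; rewrite padic_normM.
    apply: le_lt_trans (_ : A * N (v m - v n) < e).
      by rewrite ler_wpM2r ?padic_norm_ge0 ?hA.
    by rewrite mulrC -ltr_pdivlMr // hb.
  apply: le_lt_trans (_ : N (u n - u m) * B < e).
    by rewrite ler_wpM2l ?padic_norm_ge0 ?hB.
  by rewrite -ltr_pdivlMr // ha.
Qed.

HB.instance Definition _ :=
  GRing.isSubringClosed.Build (nat -> rat) (cauchy_pred p) cauchy_subring.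

Record cauchy_seq := CauchySeq {
  cauchy_val :> nat -> rat;
  _ : cauchy_val \in cauchy_pred p }.

HB.instance Definition _ := [isSub for cauchy_val].
HB.instance Definition _ := [Choice of cauchy_seq by <:].
HB.instance Definition _ := [SubChoice_isSubComNzRing of cauchy_seq by <:].

Definition null_ideal : {pred cauchy_seq} :=
  [pred u : cauchy_seq | `[< padic_null p u >]].

Lemma cauchy_seqP (u : cauchy_seq) : padic_cauchy p u.
Proof. by case: u => u /= /asboolP. Qed.

Lemma null_idealr : idealr_closed null_ideal.
Proof.
split=> [||a u v].
- by apply/asboolP => e e0; exists 0%N => n _; rewrite padic_norm0.
- apply/negP => /asboolP /(_ 1 ltr01) [n /(_ n (leqnn n))].
  by rewrite padic_norm1 ltxx.
- move=> /asboolP hu /asboolP hv; apply/asboolP => e e0.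
  have [A A0 [a0 hA]] := padic_cauchy_bounded (cauchy_seqP a).
  have [m hm] := hu _ (divr_gt0 e0 A0); have [n hn] := hv _ e0.
  exists (maxn a0 (maxn m n)) => k; rewrite !geq_max => /and3P[a0k mk nk].
  have -> : (a * u + v) k = a k * u k - - v k by rewrite opprK.
  apply: padic_normB_lt; last by rewrite padic_normN hn.
  rewrite padic_normM; apply: le_lt_trans (_ : A * N (u k) < e).
    by rewrite ler_wpM2r ?padic_norm_ge0 ?hA.
  by rewrite mulrC -ltr_pdivlMr // hm.
Qed.

HB.instance Definition _ := isIdealr.Build cauchy_seq null_ideal null_idealr.

Lemma cauchy_not_null (u : nat -> rat) : padic_cauchy p u -> ~ padic_null p u ->
  exists2 e : rat, 0 < e &
    exists n0 : nat, forall n, (n0 <= n)%N -> e <= N (u n).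
Proof.
move=> hu; apply: contra_notP => hn e e0.
have [n0 h0] := hu _ e0; exists n0 => n n0n; rewrite ltNge; apply/negP => le_e.
apply: hn; exists e => //; exists n0 => m n0m; rewrite leNgt; apply/negP => lt_e.
have := padic_normB_lt lt_e (h0 _ _ n0m n0n).
by rewrite opprB addrCA subrr addr0 ltNge le_e.
Qed.

Definition cauchy_inv_fun (u : nat -> rat) : nat -> rat :=
  if `[< padic_null p u >] then 0 else fun n => (u n)^-1.

Lemma cauchy_inv_subproof (u : cauchy_seq) : cauchy_inv_fun u \in cauchy_pred p.
Proof.
rewrite /cauchy_inv_fun; case: asboolP => [_|nu]; first exact: rpred0.
apply/asboolP => e e0.
have [d d0 [n0 hd]] := cauchy_not_null (cauchy_seqP u) nu.
have [n1 h1] := cauchy_seqP u (mulr_gt0 e0 (mulr_gt0 d0 d0)).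
exists (maxn n0 n1) => m n; rewrite !geq_max => /andP[m0 m1] /andP[k0 k1].
have um : u m != 0 by rewrite -(padic_norm_gt0 p) (lt_le_trans d0) ?hd.
have un : u n != 0 by rewrite -(padic_norm_gt0 p) (lt_le_trans d0) ?hd.
have -> : (u m)^-1 - (u n)^-1 = (u n - u m) / (u m * u n).
  by rewrite invfM mulrBl mulrCA divff // mulr1 mulrA divff // mul1r.
rewrite padic_normM padic_normV padic_normM ltr_pdivrMr; last first.
  by rewrite mulr_gt0 // padic_norm_gt0.
apply: lt_le_trans (h1 _ _ k1 m1) _.
by apply: ler_wpM2l; [exact: ltW|apply: ler_pM; rewrite ?hd // ltW].
Qed.

Definition cauchy_inv (u : cauchy_seq) : cauchy_seq :=
  CauchySeq (cauchy_inv_subproof u).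

End CauchyRing.

(* Q_p is the completion of rat for [padic_norm p]: Cauchy sequences modulo
   null sequences. *)
Definition padic (p : nat) : Type := {ideal_quot @null_ideal p}.

HB.instance Definition _ (p : nat) :=
  GRing.ComNzRing.copy (padic p) {ideal_quot @null_ideal p}.

Section PadicField.
Variable p : nat.
Local Open Scope quotient_scope.

Definition padic_class (u : cauchy_seq p) : padic p :=
  \pi_({ideal_quot @null_ideal p}) u.

Definition padic_repr (x : padic p) : cauchy_seq p :=
  repr (x : {ideal_quot @null_ideal p}).

Lemma padic_reprK x : padic_class (padic_repr x) = x.
Proof. exact: reprK. Qed.

Lemma padic_classP u v :
  padic_class u = padic_class v <-> padic_null p (u - v).
Proof.
split=> [/eqP|h]; first by rewrite /padic_class piE Quotient.equivE => /asboolP.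
by apply/eqP; rewrite /padic_class piE Quotient.equivE; apply/asboolP.
Qed.

Definition padic_inv (x : padic p) : padic p :=
  padic_class (cauchy_inv (padic_repr x)).

Lemma padic_class0 u : padic_class u = 0 <-> padic_null p u.
Proof.
have -> : (0 : padic p) = padic_class 0 by rewrite /padic_class piE.
by rewrite padic_classP subr0.
Qed.

Lemma padic_mulVf x : x != 0 -> padic_inv x * x = 1.
Proof.
move=> x0; rewrite -[x in _ * x]padic_reprK /padic_inv.
set u := padic_repr x.
have nu : ~ padic_null p u by move/padic_class0; rewrite padic_reprK; exact/eqP.
have -> : padic_class (cauchy_inv u) * padic_class u
          = padic_class (cauchy_inv u * u) by rewrite /padic_class piE.
have -> : (1 : padic p) = padic_class 1 by rewrite /padic_class piE.
apply/padic_classP => e e0.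
have [d d0 [n0 hd]] := cauchy_not_null (cauchy_seqP u) nu.
exists n0 => n n0n.
have -> : (cauchy_inv u * u - 1 : cauchy_seq p) n = cauchy_inv u n * u n - 1 by [].
have -> : cauchy_inv u n = (u n)^-1.
  by rewrite /cauchy_inv /= /cauchy_inv_fun; case: asboolP.
have un : u n != 0 by rewrite -(padic_norm_gt0 p) (lt_le_trans d0) ?hd.
by rewrite mulVf // subrr padic_norm0.
Qed.

Lemma padic_inv0 : padic_inv 0 = 0.
Proof.
apply/padic_class0; rewrite /cauchy_inv /= /cauchy_inv_fun.
case: asboolP => [_|[]]; last by apply/padic_class0; rewrite padic_reprK.
by move=> e e0; exists 0%N => n _; rewrite padic_norm0.
Qed.

HB.instance Definition _ :=
  GRing.ComNzRing_isField.Build (padic p) padic_mulVf padic_inv0.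

Definition padic_abs (R : realType) (x : padic p) : R :=
  lim ((fun n => ratr (padic_norm p (padic_repr x n)) : R) @ \oo).

End PadicField.

Section PadicAbs.
Variables (R : realType) (p : nat).
Local Notation N := (padic_norm p).

Lemma padic_norm_near x y : N (x - y) < N y -> N x = N y.
Proof.
move=> h; apply/le_anti/andP; split.
  rewrite -[in X in X <= _](subrK y x); apply: le_trans (padic_normD _ _ _) _.
  by rewrite ge_max lexx ltW.
rewrite leNgt; apply/negP => xy.
have := padic_normB_lt xy h; have -> : x - (x - y) = y by ring.
by rewrite ltxx.
Qed.

Lemma padic_null_cvg (u : nat -> rat) : padic_null p u ->
  (fun n => ratr (N (u n)) : R) @ \oo --> (0 : R).
Proof.
move=> hu; apply/cvgrPdist_lt => e e0.
have [q] := rat_in_itvoo e0; rewrite in_itv /= => /andP[q0 qe].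
have [n0 h0] := hu q ltac:(by rewrite -(ltr0q R)).
exists n0 => // n /= n0n; rewrite sub0r normrN ger0_norm ?ler0q ?padic_norm_ge0 //.
by apply: lt_trans qe; rewrite ltr_rat h0.
Qed.

Lemma padic_abs_class (u : cauchy_seq p) :
  (fun n => ratr (N (u n)) : R) @ \oo --> padic_abs R (padic_class u).
Proof.
have : padic_null p (padic_repr (padic_class u) - u : cauchy_seq p).
  by apply/padic_classP; rewrite padic_reprK.
rewrite /padic_abs; set r := padic_repr _ => hr.
have [nu|nu] := pselect (padic_null p u).
  have nr : padic_null p r.
    by apply/padic_class0; rewrite padic_reprK; apply/padic_class0.
  rewrite (cvg_lim _ (padic_null_cvg nr)); last exact: norm_hausdorff.
  exact: padic_null_cvg.
have [d d0 [n0 hd]] := cauchy_not_null (cauchy_seqP u) nu.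
have [n1 h1] := cauchy_seqP u d0; have [n2 h2] := hr _ d0.
pose M := maxn n0 (maxn n1 n2).
have uE n : (M <= n)%N -> N (u n) = N (u M).
  rewrite !geq_max => /and3P[a b _]; apply: padic_norm_near.
  by rewrite (lt_le_trans (h1 _ _ b _)) ?hd // /M !leq_max leqnn ?orbT.
have rE n : (M <= n)%N -> N (r n) = N (u M).
  move=> Mn; rewrite -(uE _ Mn); apply: padic_norm_near.
  move: Mn; rewrite !geq_max => /and3P[a b c].
  by rewrite (lt_le_trans (h2 _ c)) ?hd.
have rc : (fun n => ratr (N (r n)) : R) @ \oo --> (ratr (N (u M)) : R).
  by apply: cvg_near_cst; exists M => // n /= /rE ->.
rewrite (cvg_lim _ rc); last exact: norm_hausdorff.
by apply: cvg_near_cst; exists M => // n /= /uE ->.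
Qed.

Lemma padic_cst_subproof (q : rat) : (fun _ => q) \in cauchy_pred p.
Proof.
by apply/asboolP => e e0; exists 0%N => m n _ _; rewrite subrr padic_norm0.
Qed.

Definition padic_cst (q : rat) : cauchy_seq p := CauchySeq (padic_cst_subproof q).

Lemma padic_class_intr (z : int) : (z%:~R : padic p) = padic_class (padic_cst z%:~R).
Proof.
have nat_case (n : nat) : (n%:R : padic p) = padic_class (padic_cst n%:R).
  elim: n => [|n IH].
    apply/esym/padic_class0 => e e0; exists 0%N => n _.
    by rewrite /= padic_norm0.
  rewrite -addn1 natrD IH.
  have -> : (1%:R : padic p) = padic_class 1 by rewrite /padic_class piE.
  have -> : padic_class (padic_cst n%:R) + padic_class 1
            = padic_class (padic_cst n%:R + 1) by rewrite /padic_class piE.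
  by congr padic_class; apply/val_inj/funext => k; rewrite /= natrD.
case: z => n; first exact: nat_case.
rewrite NegzE !rmorphN /= -!pmulrn nat_case.
have -> : - padic_class (padic_cst n.+1%:R) = padic_class (- padic_cst n.+1%:R).
  by rewrite /padic_class piE.
by congr padic_class; apply/val_inj/funext.
Qed.

Lemma padic_class_ratr (q : rat) : (ratr q : padic p) = padic_class (padic_cst q).
Proof.
have d0 : ((denq q)%:~R : padic p) != 0.
  apply/eqP; rewrite padic_class_intr => /padic_class0.
  move=> /(_ (N (denq q)%:~R)); rewrite padic_norm_gt0 intr_eq0 denq_eq0.
  by move=> /(_ isT) [n /(_ n (leqnn n))]; rewrite ltxx.
apply: (mulIf d0); rewrite /ratr divfK // !padic_class_intr.
have -> : padic_class (padic_cst q) * padic_class (padic_cst (denq q)%:~R)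
   = padic_class (padic_cst q * padic_cst (denq q)%:~R) by rewrite /padic_class piE.
congr padic_class; apply/val_inj/funext => k /=.
exact: numqE.
Qed.

Lemma padic_abs_ratr (q : rat) : padic_abs R (ratr q : padic p) = ratr (N q).
Proof.
rewrite padic_class_ratr; have h := @padic_abs_class (padic_cst q).
rewrite -(cvg_lim _ h); last exact: norm_hausdorff.
by apply: cvg_lim; [exact: norm_hausdorff|rewrite /=; exact: cvg_cst].
Qed.

End PadicAbs.

Section ContinuedFraction.

(* The canonical expansion [:: a0; a1; ...; an] of a rational, in which
   an > 1 as soon as n > 0; the denominators of the successive complete
   quotients decrease, so `|denq x| is enough fuel (see [cf_evalK]). *)
Fixpoint cf_rec (n : nat) (x : rat) : seq int :=
  Num.floor x ::
    if n is n'.+1 then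
      if x == (Num.floor x)%:~R then [::] else cf_rec n' (x - (Num.floor x)%:~R)^-1
    else [::].

Definition partial_quotients (x : rat) : seq int := cf_rec `|denq x| x.

Definition cf_eval (s : seq int) : rat := foldr (fun a y => a%:~R + y^-1) 0 s.

Lemma cf_evalK x : cf_eval (partial_quotients x) = x.
Proof.
rewrite /partial_quotients; move: {-1}`|denq x|%N (leqnn `|denq x|%N) => n.
elim: n x => [|n IH] x; first by rewrite leqn0 absz_eq0 denq_eq0.
move=> xn /=; set a := Num.floor x; case: eqP => [->|/eqP xa] /=.
  by rewrite invr0 addr0.
rewrite IH ?invrK; first by rewrite addrC subrK.
have y0 : 0 < x - a%:~R by rewrite lt_def subr_eq0 xa subr_ge0 floor_le.
have y1 : x - a%:~R < 1 by rewrite ltrBlDl -[X in _ + X]/(1%:~R) -rmorphD /= floorD1_gt.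
set r := numq x - a * denq x.
have E : x - a%:~R = r%:~R / (denq x)%:~R.
  by rewrite rmorphB rmorphM /= mulrBl mulfK ?intr_eq0 ?denq_eq0 // divq_num_den.
have r0 : 0 < r by rewrite -(ltr0z rat); move: y0; rewrite E pmulr_lgt0 // invr_gt0 ltr0z denq_gt0.
have rd : r < denq x by rewrite -(ltr_int rat); move: y1; rewrite E ltr_pdivrMr ?mul1r // ltr0z denq_gt0.
rewrite E invf_div; set y := _ / _.
have dy : (`|denq y| %| `|r|)%N.
  rewrite -(@Gauss_dvdr _ `|numq y|) 1?coprime_sym ?coprime_num_den //.
  rewrite -abszM; have -> : numq y * r = denq x * denq y.
    apply: (@intr_inj rat); rewrite !rmorphM /=.
    apply/eqP; rewrite -eqr_div ?intr_eq0 ?denq_eq0 ?lt0r_neq0 //.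
    by rewrite divq_num_den.
  by rewrite abszM dvdn_mull.
rewrite -ltnS; apply: leq_trans xn.
apply: leq_ltn_trans (dvdn_leq _ dy) _; first by rewrite absz_gt0 lt0r_neq0.
by rewrite -ltz_nat !gtz0_abs ?denq_gt0.
Qed.

Definition largest_partial_quotient (x : rat) : int :=
  let s := partial_quotients x in foldr Num.max (head 0 s) s.

End ContinuedFraction.

Section Exponents.
Variables (R : realType) (p : nat).
Local Open Scope ereal_scope.

Definition is_padic_series_sum (c : nat -> int) (xi : padic p) : Prop :=
  (fun n => padic_abs R (xi - \sum_(k < n) (c k)%:~R * p%:R ^+ k)%R)
    @ \oo --> (0 : R)%R.

Definition padic_truncation (c : nat -> int) (m : nat) : rat :=
  (\sum_(k < m) (c k)%:~R / p%:R ^+ (m - k))%R.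

(* The real number e such that the largest partial quotient of x_m equals
   p^(e m). It exists and is unique as soon as x_m has a positive partial
   quotient, which excludes only finitely many m when the series is
   irrational; the value 0 used for the others does not affect the limits. *)
Definition eta_seq (c : nat -> int) (m : nat) : R :=
  xget 0%R [set e : R | (largest_partial_quotient (padic_truncation c m))%:~R%R
                      = (p%:R `^ (e * m%:R))%R].

Definition eta (c : nat -> int) : \bar R :=
  limn_esup (fun m => (eta_seq c m)%:E).

Definition eta_hat (c : nat -> int) : \bar R :=
  limn_einf (fun m => (eta_seq c m)%:E).

Definition mult_height (a b : int) : R := Num.sqrt (`|(a * b)%:~R|)%R.

Definition mult_exponent (xi : padic p) : \bar R :=
  ereal_sup [set mu%:E | mu in [set mu : R |
    infinite_set [set ab : int * int |
      [/\ ab.1 != 0%R, ab.2 != 0%R,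
          (0 < padic_abs R (ab.2%:~R * xi - ab.1%:~R))%R &
          (padic_abs R (ab.2%:~R * xi - ab.1%:~R)
             <= mult_height ab.1 ab.2 `^ (- mu))%R]]]].

Definition unif_mult_exponent (xi : padic p) : \bar R :=
  ereal_sup [set mu%:E | mu in [set mu : R |
    \forall X \near +oo%R, exists a b : int,
      [/\ (0 < mult_height a b)%R, (mult_height a b <= X)%R &
          (padic_abs R (b%:~R * xi - a%:~R) <= X `^ (- mu))%R]]].

End Exponents.

(* Main.v *)
Require Import Defs.
From mathcomp Require Import all_boot all_order all_algebra.
From mathcomp Require Import all_classical all_reals all_analysis.
From mathcomp Require Import ring lra zify.
Import Order.TTheory GRing.Theory Num.Theory.
Import numFieldNormedType.Exports.
Local Open Scope classical_set_scope.
Local Open Scope ring_scope.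

(* Write S_m = c_0 + ... + c_(m-1) p^(m-1), so that x_m = S_m / p^m. Then
   |b xi - a|_p <= p^-m iff p^m divides b S_m - a, i.e. iff
   a = p^m (b x_m - y) for some integer y, and in that case
   |a b| = p^m |b| |b x_m - y|. For a rational x with largest partial quotient
   M, the minimum of |b| |b x - y| over the pairs for which it does not vanish
   is 1 / M up to a bounded factor. Hence the smallest nonzero |a b| at level m
   is p^(m (1 - eta_m)) up to a bounded factor, and both exponents are read off
   by comparing this with p^-m along suitable, or along all, m. *)

(** * Partial quotients and the products |b| |b x - y| *)

Lemma intr_norm_ge1 {F : numDomainType} {z : int} : z != 0 -> 1 <= `|z%:~R : F|.
Proof.
by move=> z0; rewrite -intr_norm -[leLHS]/(1%:~R) ler_int -gtz0_ge1 normr_gt0.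
Qed.

Lemma ltr0_intS {F : numDomainType} {z : int} : z < 0 -> (z%:~R : F) <= -1.
Proof.
by move=> z0; rewrite -[leRHS]/((-1)%:~R) ler_int -ltzD1 addNr.
Qed.

Lemma gtr0_intS {F : numDomainType} {z : int} : 0 < z -> 1 <= (z%:~R : F).
Proof. by move=> z0; rewrite -[leLHS]/(1%:~R) ler_int -gtz0_ge1. Qed.

(** One step of the Euclidean algorithm: passing to the next complete quotient replaces the pair
    [(d', d)] by [(d, d' - a d)]. *)
Lemma pq_next_lt (d' d : rat) (a := Num.floor (d' / d)) : 0 < d -> d < d' ->
  d' / d != a%:~R ->
  [/\ 1 <= (a%:~R : rat), 0 < d' - a%:~R * d, d' - a%:~R * d < d &
      (d' / d - a%:~R)^-1 = d / (d' - a%:~R * d)].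
Proof.
move=> d0 dd' Xa.
have a1 : 1 <= (a%:~R : rat).
  by rewrite -[leLHS]/(1%:~R) ler_int /a floor_ge_int /= ler_pdivlMr ?mul1r // ltW.
have E : d' / d - a%:~R = (d' - a%:~R * d) / d.
  by rewrite mulrBl mulfK ?gt_eqF.
have y0 : 0 < d' / d - a%:~R by rewrite lt_def subr_eq0 Xa subr_ge0 floor_le.
have y1 : d' / d - a%:~R < 1.
  by rewrite ltrBlDl -[X in _ + X]/(1%:~R) -rmorphD /= floorD1_gt.
split=> //.
- by move: y0; rewrite E pmulr_lgt0 // invr_gt0.
- by move: y1; rewrite E ltr_pdivrMr ?mul1r.
- by rewrite E invf_div.
Qed.

(* (q', d') and (q, - d) are two consecutive vectors (b, b x - y) produced by
   the continued fraction algorithm, and d' / d is the current complete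
   quotient; the determinant q' d + q d' does not change along the way. *)
Lemma cf_rec_good_vector n {X : rat} (q' q d' d : rat) :
  0 < d -> d < d' -> 0 <= q' -> 0 < q -> X = d' / d ->
  forall a, a \in cf_rec n X -> exists u t : int,
    [/\ 0 < u%:~R * q' + t%:~R * q, u%:~R * d' - t%:~R * d != 0 &
      (u%:~R * q' + t%:~R * q) * `|u%:~R * d' - t%:~R * d| * a%:~R
        <= q' * d + q * d'].
Proof.
have head (q1 q2 d1 d2 : rat) : 0 < d2 -> d2 < d1 -> 0 <= q1 -> 0 < q2 ->
   exists u t : int,
    [/\ 0 < u%:~R * q1 + t%:~R * q2, u%:~R * d1 - t%:~R * d2 != 0 &
      (u%:~R * q1 + t%:~R * q2) * `|u%:~R * d1 - t%:~R * d2|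
        * (Num.floor (d1 / d2))%:~R <= q1 * d2 + q2 * d1].
  (* The second vector alone serves for the leading partial quotient, since
     [floor (d1 / d2) * d2 <= d1]. *)
  move=> d0 dd' q1_0 q0; exists 0, 1.
  rewrite !mul0r !add0r mul1r mul1r oppr_eq0 normrN gtr0_norm //; split=> //.
    by rewrite gt_eqF.
  have : (Num.floor (d1 / d2))%:~R * d2 <= d1 by rewrite -ler_pdivlMr // floor_le.
  by move: (Num.floor _)%:~R => f; nra.
elim: n X q' q d' d => [|n IH] X q' q d' d d0 dd' q'0 q0 -> a /=.
  by rewrite inE => /eqP ->; exact: head.
rewrite inE => /predU1P[->|]; first exact: head.
case: eqP => // /eqP /(pq_next_lt _ _ d0 dd'); set b := Num.floor _.
move=> [b1 e0 ed EX].
have q''0 : 0 < q' + b%:~R * q.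
  by rewrite ltr_wpDl // mulr_gt0 // (lt_le_trans ltr01).
move=> /(IH _ q _ d _ e0 ed (ltW q0) q''0 EX) [u [t [h1 h2 h3]]].
(* Coordinates of the same vector, up to the sign of its second entry, in the previous basis. *)
exists t, (u + t * b); rewrite !rmorphD !rmorphM /=.
have E1 : t%:~R * q' + (u%:~R + t%:~R * b%:~R) * q
   = u%:~R * q + t%:~R * (q' + b%:~R * q) by ring.
have E2 : t%:~R * d' - (u%:~R + t%:~R * b%:~R) * d
   = - (u%:~R * d - t%:~R * (d' - b%:~R * d)) by ring.
rewrite E1 E2 normrN oppr_eq0; split=> //; apply: le_trans h3 _.
by rewrite le_eqVlt; apply/orP; left; apply/eqP; ring.
Qed.

(** Best approximation property: if the first coordinate lies in size between the consecutive
    denominators [q] and [q''], the second is at least [d], while the determinant is at most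
    [(M + 2) q d]. Larger first coordinates are left to the next step. The hypothesis on [cf_eval]
    ensures that the recursion does not stop for lack of fuel. *)
Lemma cf_rec_bad_vectors n {X : rat} (q' q d' d : rat) (M : rat) :
  0 < d -> d < d' -> 0 <= q' -> q' <= q -> 0 < q -> X = d' / d ->
  cf_eval (cf_rec n X) = X ->
  (forall a, a \in cf_rec n X -> a%:~R <= M) ->
  forall u t : int, u%:~R * d' - t%:~R * d != 0 ->
    q <= `|u%:~R * q' + t%:~R * q| ->
    q' * d + q * d'
      <= (M + 2) * (`|u%:~R * q' + t%:~R * q| * `|u%:~R * d' - t%:~R * d|).
Proof.
elim: n X q' q d' d => [|n IH] X q' q d' d d0 dd' q'0 q'q q0 EX.
all: set a := Num.floor X; rewrite /= -/a.
(* When the complete quotient is an integer, the second coordinate is a nonzero multiple of [d], and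
   the determinant is at most [(M + 1) q d]. *)
all: have integer_case : X = a%:~R -> a%:~R <= M ->
       forall u t : int, u%:~R * d' - t%:~R * d != 0 ->
       q <= `|u%:~R * q' + t%:~R * q| ->
       q' * d + q * d'
        <= (M + 2) * (`|u%:~R * q' + t%:~R * q| * `|u%:~R * d' - t%:~R * d|).
1,3: move=> Xa aM u t w2 qw1.
1,2: have Ed' : d' = a%:~R * d by rewrite -Xa EX divfK ?gt_eqF.
1,2: have Ew : u%:~R * d' - t%:~R * d = (u * a - t)%:~R * d
       by rewrite Ed' rmorphB rmorphM /=; ring.
1,2: have dw2 : d <= `|u%:~R * d' - t%:~R * d|.
1,3: move: w2; rewrite Ew mulf_eq0 negb_or intr_eq0 => /andP[z0 _].
1,2: by rewrite normrM (gtr0_norm d0) ler_peMl ?(ltW d0) // intr_norm_ge1.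
1,2: have a1 : 1 <= (a%:~R : rat)
       by rewrite -(ler_pM2r d0) mul1r -Ed' ltW.
1,2: apply: le_trans (_ : (M + 2) * (q * d) <= _);
     [have := mulr_ge0 (ltW q0) (ltW d0); rewrite {1}Ed'; nra
     |by rewrite ler_wpM2l ?ler_pM ?(ltW q0) ?(ltW d0) //; lra].
- by rewrite invr0 addr0 => /esym Xa aM; apply: integer_case => //; rewrite aM ?inE.
- have [Xa _ aM|/eqP Xa ev aM] := eqP.
    by apply: integer_case => //; rewrite aM ?inE.
  have aM' : a%:~R <= M by apply: aM; rewrite inE eqxx.
  have [] := @pq_next_lt d' d d0 dd' _; rewrite -EX -/a // => a1 e0 ed EX'.
  set q'' := q' + a%:~R * q; set d'' := d' - a%:~R * d.
  have qq'' : q <= q'' by rewrite /q''; nra.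
  move=> u t w2 qw1.
  have E1 : u%:~R * q' + t%:~R * q = (t - u * a)%:~R * q + u%:~R * q''.
    by rewrite rmorphB rmorphM /= /q''; ring.
  have E2 : u%:~R * d' - t%:~R * d = - ((t - u * a)%:~R * d - u%:~R * d'').
    by rewrite rmorphB rmorphM /= /d''; ring.
  have ED : q' * d + q * d' = q * d'' + q'' * d by rewrite /q'' /d''; ring.
  move: w2 qw1; rewrite E1 E2 ED normrN oppr_eq0 => w2 qw1.
  have [q''w1|w1q''] := leP q'' `|(t - u * a)%:~R * q + u%:~R * q''|.
    apply: IH EX' _ _ _ _ w2 q''w1 => //.
    - exact: ltW.
    - exact: lt_le_trans qq''.
    - have := congr1 (fun x => (x - a%:~R)^-1) ev.
      by rewrite /= [_ + _^-1]addrC addrK invrK.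
    - by move=> b bs; apply: aM; rewrite inE bs orbT.
  move: w2 qw1 w1q''; set v := t - u * a => w2 qw1.
  rewrite ltr_norml => /andP[w1l w1u].
  have q''0 : 0 <= q'' := le_trans (ltW q0) qq''.
  have d''0 : 0 <= d'' := ltW e0.
  (* As |w1| < q'', v and u cannot have the same sign, so that the two terms
     of v d - u d'' add up in absolute value. *)
  have dw2 : d <= `|v%:~R * d - u%:~R * d''|.
    have [u0|u0|u0] := ltgtP u 0.
    + have {}u0 := @ltr0_intS rat _ u0.
      have v0 : 0 < v by rewrite -(ltr0z rat) -(pmulr_lgt0 _ q0);
        have := mulr_ge0 q''0 (_ : 0 <= -1 - u%:~R); rewrite subr_ge0 => /(_ u0); lra.
      have {}v0 := @gtr0_intS rat _ v0.
      apply: le_trans (ler_norm _).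
      have := mulr_ge0 d''0 (_ : 0 <= - u%:~R);
        have := mulr_ge0 (ltW d0) (_ : 0 <= v%:~R - 1).
      rewrite subr_ge0 oppr_ge0 => /(_ v0) h1 /(_ (le_trans u0 (lerN10 _))); lra.
    + have {}u0 := @gtr0_intS rat _ u0.
      have v0 : v < 0 by rewrite -(ltrz0 rat) -(pmulr_llt0 _ q0);
        have := mulr_ge0 q''0 (_ : 0 <= u%:~R - 1); rewrite subr_ge0 => /(_ u0); lra.
      have {}v0 := @ltr0_intS rat _ v0.
      rewrite -normrN; apply: le_trans (ler_norm _).
      have := mulr_ge0 d''0 (_ : 0 <= u%:~R);
        have := mulr_ge0 (ltW d0) (_ : 0 <= -1 - v%:~R).
      rewrite subr_ge0 => /(_ v0) h1 /(_ (le_trans ler01 u0)); lra.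
    + move: w2; rewrite u0 mul0r subr0 mulf_eq0 negb_or intr_eq0 => /andP[v0 _].
      by rewrite normrM (gtr0_norm d0) ler_peMl ?(ltW d0) // intr_norm_ge1.
  (* The terms [q d''], [q' d] and [a q d] of the determinant are at most [q d], [q d] and
     [M q d]. *)
  apply: le_trans (_ : (M + 2) * (q * d) <= _).
    have := ler_wpM2r (mulr_ge0 (ltW q0) (ltW d0)) aM'.
    have := ler_wpM2l (ltW q0) (ltW ed); have := ler_wpM2r (ltW d0) q'q.
    by rewrite -/d'' /q''; lra.
  by rewrite ler_wpM2l ?ler_pM ?(ltW q0) ?(ltW d0) //; lra.
Qed.

Lemma foldr_max_mem {s : seq int} {z : int} :
  foldr Num.max z s \in z :: s.
Proof.
elim: s => [|a s IH] /=; first by rewrite inE.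
rewrite maxEle; case: ifP => _; last by rewrite !inE eqxx orbT.
by move: IH; rewrite !inE => /orP[->//|->]; rewrite !orbT.
Qed.

Lemma le_foldr_max {s : seq int} {z a : int} :
  a \in s -> a <= foldr Num.max z s.
Proof.
by elim: s => //= b s IH; rewrite inE le_max => /predU1P[->|/IH ->];
  rewrite ?lexx ?orbT.
Qed.

Section LargestPartialQuotient.

Variable x : rat.
Hypothesis x_nint : x \isn't a Num.int.

(** Splits off the integer part, which may have any sign; the remaining complete quotient exceeds 1,
    as the lemmas on [cf_rec] require. *)
Lemma pq_nint : exists n, [/\ 0 < x - (Num.floor x)%:~R,
    x - (Num.floor x)%:~R < 1 &
    partial_quotients x = Num.floor x :: cf_rec n (x - (Num.floor x)%:~R)^-1].
Proof.
have xa : x != (Num.floor x)%:~R.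
  by apply: contraNneq x_nint => ->; apply: intr_int.
exists `|denq x|%N.-1; split.
- by rewrite lt_def subr_eq0 xa subr_ge0 floor_le.
- by rewrite ltrBlDl -[X in _ + X]/(1%:~R) -rmorphD /= floorD1_gt.
- rewrite /partial_quotients.
  have : `|denq x|%N != 0%N by rewrite absz_eq0 denq_eq0.
  by case: `|denq x|%N => //= n _; rewrite (negbTE xa).
Qed.

Lemma largest_pq_ge1 : 1 <= largest_partial_quotient x.
Proof.
have [n [y0 y1 E]] := pq_nint; rewrite /largest_partial_quotient E.
apply: le_trans (le_foldr_max (a := Num.floor (x - (Num.floor x)%:~R)^-1) _).
  by rewrite floor_ge_int /= invf_ge1 // ltW.
by rewrite inE; case: n {E} => [|n] /=; rewrite inE eqxx orbT.
Qed.

(** If the maximum is the integer part of [x], then [b = 1] works and [K] bounds the product.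
    Otherwise [cf_rec_good_vector] is run from the vectors [(0, 1)] and [(1, floor x - x)], of
    determinant 1. *)
Lemma largest_pq_good (K : rat) : 1 <= K -> x <= K ->
  exists b y : int, [/\ 0 < b, b%:~R * x - y%:~R != 0 &
    b%:~R * `|b%:~R * x - y%:~R| * (largest_partial_quotient x)%:~R <= K].
Proof.
move=> K1 xK; have [n [y0 y1 E]] := pq_nint; set a0 := Num.floor x.
have : largest_partial_quotient x \in partial_quotients x.
  rewrite /largest_partial_quotient E.
  by have := @foldr_max_mem (a0 :: cf_rec n (x - a0%:~R)^-1) a0; rewrite !inE orbA orbb.
rewrite E inE => /predU1P[->|].
  exists 1, a0; rewrite !mul1r gt_eqF // gtr0_norm //; split=> //.
  apply: le_trans (_ : 1 * K <= _); last by rewrite mul1r.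
  have [a00|a00] := leP 0 (a0%:~R : rat).
    by rewrite ler_pM ?(ltW y0) ?(ltW y1) // (le_trans (floor_le _)).
  by rewrite mul1r; have := ltW y0; rewrite -/a0; nra.
have EX : (x - a0%:~R)^-1 = 1 / (x - a0%:~R) by rewrite mul1r.
case/(cf_rec_good_vector _ 0 1 _ _ y0 y1 (lexx _) ltr01 EX) => u [t].
rewrite mulr0 add0r mulr1 mul0r add0r mulr1 mulr1 => -[t0 w2 h].
exists t, (u + t * a0); rewrite -(ltr0z rat) t0.
have -> : t%:~R * x - (u + t * a0)%:~R = - (u%:~R - t%:~R * (x - a0%:~R)).
  by rewrite rmorphD rmorphM /=; ring.
by rewrite oppr_eq0 normrN; split=> //; apply: le_trans K1.
Qed.

(** The same starting vectors have [q = 1], so any nonzero [b] meets the size condition of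
    [cf_rec_bad_vectors]. *)
Lemma largest_pq_bad (b y : int) : b != 0 -> b%:~R * x - y%:~R != 0 ->
  1 <= ((largest_partial_quotient x)%:~R + 2)
         * (`|b%:~R| * `|b%:~R * x - y%:~R|).
Proof.
move=> b0 w2; have [n [y0 y1 E]] := pq_nint; set a0 := Num.floor x.
have Ex : (x - a0%:~R)^-1 = 1 / (x - a0%:~R) by rewrite mul1r.
have Ew : (y - b * a0)%:~R * 1 - b%:~R * (x - a0%:~R) = - (b%:~R * x - y%:~R).
  by rewrite rmorphB rmorphM /=; ring.
have := @cf_rec_bad_vectors n _ 0 1 1 (x - a0%:~R)
  (largest_partial_quotient x)%:~R y0 y1 (lexx _) ler01 ltr01 Ex.
rewrite mul0r add0r mulr1.
have -> : cf_eval (cf_rec n (x - a0%:~R)^-1) = (x - a0%:~R)^-1.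
  have := cf_evalK x; rewrite E /= => /(congr1 (fun z => (z - a0%:~R)^-1)).
  by rewrite /= [_ + _^-1]addrC addrK invrK.
move=> /(_ erefl) H; have := H _ (y - b * a0) b; rewrite Ew oppr_eq0 normrN mulr0.
rewrite add0r mulr1; apply=> //; last exact: intr_norm_ge1.
move=> a ain; rewrite ler_int /largest_partial_quotient le_foldr_max //.
by rewrite E inE ain orbT.
Qed.

End LargestPartialQuotient.

(** * The p-adic absolute value *)

Section PadicAbsTheory.
Variables (R : realType) (p : nat).
Implicit Types (x y : padic p) (z : int).
Local Notation N := (@padic_abs p R).

Let padic_rep x : exists u : cauchy_seq p, x = padic_class u.
Proof. by exists (padic_repr x); rewrite padic_reprK. Qed.

Lemma padic_abs_ge0 x : 0 <= N x.
Proof.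
have [u ->] := padic_rep x.
have h := @padic_abs_class R p u.
rewrite -(cvg_lim (@norm_hausdorff _ _) h); apply: limr_ge.
  by apply/cvg_ex; eexists; exact: h.
by apply: nearW => n; rewrite ler0q padic_norm_ge0.
Qed.

Lemma padic_absM x y : N (x * y) = N x * N y.
Proof.
have [u ->] := padic_rep x; have [v ->] := padic_rep y.
have -> : padic_class u * padic_class v = padic_class (u * v).
  by rewrite /padic_class piE.
rewrite -(cvg_lim (@norm_hausdorff _ _) (@padic_abs_class R p (u * v))).
have -> : (fun n => ratr (padic_norm p ((u * v : cauchy_seq p) n)) : R)
     = (fun n => ratr (padic_norm p (u n)) * ratr (padic_norm p (v n))).
  by apply/funext => n; rewrite -rmorphM /= -padic_normM.
apply: cvg_lim; first exact: norm_hausdorff.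
by apply: cvgM; exact: padic_abs_class.
Qed.

(** Strict bounds on the limits hold for almost all terms of the representing sequences, where the
    rational ultrametric inequality applies; [padic_absD] recovers the non-strict form. *)
Lemma padic_absD_le x y (e : R) : N x < e -> N y < e -> N (x + y) <= e.
Proof.
have [u ->] := padic_rep x; have [v ->] := padic_rep y.
have -> : padic_class u + padic_class v = padic_class (u + v).
  by rewrite /padic_class piE.
move=> ue ve; have h := @padic_abs_class R p (u + v).
rewrite -(cvg_lim (@norm_hausdorff _ _) h); apply: limr_le.
  by apply/cvg_ex; eexists; exact: h.
near=> n; apply: (@le_trans _ _
    (Num.max (ratr (padic_norm p (u n))) (ratr (padic_norm p (v n))))).
  have := padic_normD p (u n) (v n).
  by rewrite !le_max !ler_rat.
rewrite ge_max; apply/andP; split; apply: ltW; near: n.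
- by have /cvgr_lt := @padic_abs_class R p u; apply.
- by have /cvgr_lt := @padic_abs_class R p v; apply.
Unshelve. all: by end_near. Qed.

Lemma padic_absD x y (e : R) : N x <= e -> N y <= e -> N (x + y) <= e.
Proof.
move=> xe ye; apply/ler_addgt0Pr => d d0.
by apply: padic_absD_le; rewrite (le_lt_trans xe,le_lt_trans ye) // ltrDl.
Qed.

Lemma padic_abs_int z : N (z%:~R) = ratr (padic_norm p z%:~R).
Proof. by rewrite -padic_abs_ratr ratr_int. Qed.

Lemma padic_absN x : N (- x) = N x.
Proof.
rewrite -mulN1r padic_absM -[-1]/((-1)%:~R) padic_abs_int.
by rewrite rmorphN1 padic_normN padic_norm1 rmorph1 mul1r.
Qed.

Lemma padic_abs_gt0 x : x != 0 -> 0 < N x.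
Proof.
move=> x0; rewrite lt_def padic_abs_ge0 andbT; apply/eqP => x00.
have := padic_absM x x^-1; rewrite x00 mul0r divff // -[1]/(1%:~R).
by rewrite padic_abs_int padic_norm1 rmorph1 => /eqP; rewrite oner_eq0.
Qed.

Hypothesis p_prime : prime p.

Lemma padic_abs_int_le z m : (N (z%:~R) <= p%:R ^- m) = ((p ^ m)%N%:Z %| z)%Z.
Proof.
rewrite padic_abs_int dvdzE absz_nat.
have [->|z0] := eqVneq z 0.
  by rewrite padic_norm0 rmorph0 dvdn0 invr_ge0 exprn_ge0.
have := @padic_norm_frac p z 1 z0 isT; rewrite divr1 => ->.
rewrite logn1 sub0r pfactor_dvdn ?absz_gt0 //.
have -> : (p%:R : R) ^- m = ratr ((p%:R : rat) ^ (- m%:Z)).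
  by rewrite -invr_expz fmorphV rmorphXn /= ratr_nat.
by rewrite ler_rat ler_eXz2l ?ltr1n ?prime_gt1 // lerN2.
Qed.

Lemma padic_abs_int_le1 z : N (z%:~R) <= 1.
Proof. by have := padic_abs_int_le z 0; rewrite expr0 invr1 dvd1z. Qed.

Variables (c : nat -> int) (xi : padic p).
Hypothesis xi_sum : is_padic_series_sum R c xi.

Definition partial_sum m : int := \sum_(k < m) c k * (p ^ k)%N%:Z.

Lemma padic_truncationE m : padic_truncation p c m = (partial_sum m)%:~R / p%:R ^+ m.
Proof.
rewrite /padic_truncation /partial_sum rmorph_sum mulr_suml; apply: eq_bigr => k _.
by rewrite rmorphM /= -pmulrn natrX -mulrA expfB // invf_div.
Qed.

(** For large [n >= m] the difference [xi - S_n] is small by convergence, and [p^m] divides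
    [S_n - S_m]. *)
Lemma padic_abs_tail m : N (xi - (partial_sum m)%:~R) <= p%:R ^- m.
Proof.
have pm0 : 0 < p%:R ^- m :> R by rewrite invr_gt0 exprn_gt0 // ltr0n prime_gt0.
have /cvgr_lt/(_ _ pm0) [n0 _ hN] := xi_sum.
have [n mn n0n] : exists2 n, (m <= n)%N & (n0 <= n)%N.
  by exists (maxn m n0); rewrite ?leq_maxl ?leq_maxr.
rewrite -(subrK (\sum_(k < n) (c k)%:~R * p%:R ^+ k) xi) -addrA.
apply: padic_absD; first exact: ltW (hN _ n0n).
have -> : \sum_(k < n) (c k)%:~R * p%:R ^+ k = (partial_sum n)%:~R :> padic p.
  by rewrite rmorph_sum; apply: eq_bigr => k _; rewrite rmorphM /= -pmulrn natrX.
rewrite -rmorphB /= padic_abs_int_le /partial_sum -(subnKC mn) big_split_ord /=.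
rewrite [X in (_ %| X - _)%Z]addrC addrK; apply: rpred_sum => k _.
by rewrite expnD PoszM mulrCA dvdz_mulr.
Qed.

(** An integer [b] has absolute value at most 1, so replacing [xi] by [S_m] changes [b xi - a] by at
    most [p^-m]. *)
Lemma padic_abs_approx (a b : int) m :
  (N (b%:~R * xi - a%:~R) <= p%:R ^- m)
    = ((p ^ m)%N%:Z %| b * partial_sum m - a)%Z.
Proof.
rewrite -padic_abs_int_le.
have tail : N (b%:~R * (xi - (partial_sum m)%:~R)) <= p%:R ^- m.
  rewrite padic_absM -[leRHS]mul1r ler_pM ?padic_abs_ge0 ?padic_abs_int_le1 //.
  exact: padic_abs_tail.
have E : b%:~R * xi - a%:~R = b%:~R * (xi - (partial_sum m)%:~R)
    + (b * partial_sum m - a)%:~R by rewrite rmorphB rmorphM /=; ring.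
apply/idP/idP => h; last by rewrite E padic_absD.
rewrite -[X in N X](addKr (b%:~R * (xi - (partial_sum m)%:~R))) -E.
by rewrite padic_absD ?padic_absN.
Qed.

End PadicAbsTheory.

(** * Upper and lower limits *)

Section LimnEsup.
Variable R : realType.
Local Open Scope ereal_scope.
Implicit Types (u : (\bar R)^nat) (e : \bar R).

Lemma limn_esup_lt u e : limn_esup u < e ->
  exists n0, forall n, (n0 <= n)%N -> u n < e.
Proof.
move=> /ereal_inf_lt[_ [V [n0 _ Vn0] <-] Ve]; exists n0 => n n0n.
apply: le_lt_trans Ve; apply: ereal_sup_ubound.
by exists n => //; apply: Vn0.
Qed.

Lemma lt_limn_esup u e : e < limn_esup u ->
  forall n0, exists2 n, (n0 <= n)%N & e < u n.
Proof.
move=> eu n0.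
have /ereal_sup_gt[_ [n /= n0n <-] en] :
  e < ereal_sup (u @` [set n | (n0 <= n)%N]).
  apply: lt_le_trans eu _; apply: ereal_inf_lbound.
  by exists [set n | (n0 <= n)%N] => //; exists n0.
by exists n.
Qed.

Lemma limn_einf_lt u e : limn_einf u < e ->
  forall n0, exists2 n, (n0 <= n)%N & u n < e.
Proof.
rewrite /limn_einf lteNl => /lt_limn_esup h n0.
by have [n n0n] := h n0; rewrite lteN2 => ?; exists n.
Qed.

Lemma lt_limn_einf u e : e < limn_einf u ->
  exists n0, forall n, (n0 <= n)%N -> e < u n.
Proof.
rewrite /limn_einf lteNr => /limn_esup_lt[n0 h].
by exists n0 => n /h; rewrite lteN2.
Qed.

(* The convention 2 / 0 = +oo is the one built into the inverse on \bar R. *)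
Lemma ereal_sup_exponent (S : set R) (t : R) : (t <= 1)%R ->
  (forall mu, 0 < mu -> mu * (1 - t) < 2 -> S mu)%R ->
  (forall mu, 0 < mu -> S mu -> mu * (1 - t) <= 2)%R ->
  ereal_sup [set mu%:E | mu in S] = 2%:E / (1%:E - t%:E).
Proof.
move=> t1 SI SE; have [t1E|t1N] := eqVneq (1 - t)%R 0%R.
  (* For [t = 1] every positive [mu] is admissible, so the supremum is infinite. *)
  rewrite -EFinB t1E inve0 gt0_muley ?lte_fin//; apply/eq_infty => r.
  apply: le_trans (_ : (Num.max r 1)%:E <= _); first by rewrite lee_fin le_max lexx.
  apply: ereal_sup_ubound; exists (Num.max r 1)%R => //.
  by apply: SI; rewrite ?t1E ?mulr0 // lt_max ltr01 orbT.
have t10 : (0 < 1 - t)%R by rewrite lt_def t1N subr_ge0.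
rewrite -EFinB inver (negbTE t1N) -EFinM; apply/eqP; rewrite eq_le; apply/andP; split.
  apply/ereal_supP => _ [mu Smu <-]; rewrite lee_fin.
  have [mu0|mu0] := leP mu 0%R; first by rewrite (le_trans mu0) // divr_ge0 // ltW.
  by rewrite ler_pdivlMr // SE.
apply/lee_addgt0Pr => e e0; rewrite -leeBlDr //.
have [mu0|mu0] := leP (2 / (1 - t) - e)%R 0%R.
  (* A nonpositive [2 / (1 - t) - e] lies below half of [2 / (1 - t)], which is a positive
     admissible exponent. *)
  apply: le_trans (_ : (2 / (1 - t) / 2 : R)%:E <= _).
    by rewrite -EFinB lee_fin (le_trans mu0) // !divr_ge0 // ltW.
  apply: ereal_sup_ubound; exists (2 / (1 - t) / 2)%R => //; apply: SI.
    by rewrite !divr_gt0.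
  by rewrite mulrAC divfK //; lra.
apply: ereal_sup_ubound; exists (2 / (1 - t) - e)%R; last by rewrite EFinB.
by apply: SI => //; rewrite mulrBl divfK // ltrBlDr ltrDl mulr_gt0.
Qed.

End LimnEsup.

(** * Small multiples of xi *)

Lemma natr_mul_large {R : realType} (d C : R) : 0 < d ->
  exists n0, forall n, (n0 <= n)%N -> C < n%:R * d.
Proof.
move=> d0; exists (Num.bound `|C / d|) => n n0n.
rewrite -ltr_pdivrMr //; apply: le_lt_trans (ler_norm _) _.
apply: lt_le_trans (_ : (Num.bound `|C / d|)%:R <= _); last by rewrite ler_nat.
by rewrite archi_boundP.
Qed.

Section Approximations.
Variables (R : realType) (p : nat) (c : nat -> int) (xi : padic p).
Hypothesis p_prime : prime p.
Hypothesis xi_sum : is_padic_series_sum R c xi.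
Local Notation N := (@padic_abs p R).
Local Notation S := (partial_sum p c).
Local Notation M m := (largest_partial_quotient (padic_truncation p c m)).

Let pX_gt0 m : 0 < (p%:R : rat) ^+ m.
Proof. by rewrite exprn_gt0 // ltr0n prime_gt0. Qed.

Let pXE m : (p%:R : rat) ^+ m = ((p ^ m)%N%:Z)%:~R.
Proof. by rewrite -pmulrn natrX. Qed.

Let form_truncation m (b y : int) :
  b%:~R * padic_truncation p c m - y%:~R
    = (b * S m - y * (p ^ m)%N%:Z)%:~R / p%:R ^+ m.
Proof.
rewrite padic_truncationE // rmorphB !rmorphM /= -pXE mulrBl mulrA mulfK //.
by rewrite gt_eqF.
Qed.

(** The quotient [y] given by divisibility satisfies [b x_m - y = a / p^m]; the factor 3 absorbs the
    [M + 2] of [largest_pq_bad], as [M >= 1]. *)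
Lemma approximation_bound m (a b : int) :
  padic_truncation p c m \isn't a Num.int -> a * b != 0 ->
  N (b%:~R * xi - a%:~R) <= p%:R ^- m ->
  (p ^ m)%N%:Z <= 3 * M m * `|a * b|.
Proof.
move=> x_nint; rewrite mulf_eq0 negb_or => /andP[a0 b0].
rewrite (padic_abs_approx _ _ p_prime _ _ xi_sum) => /dvdzP[y Ey].
have Ea : b * S m - y * (p ^ m)%N%:Z = a by rewrite -Ey; ring.
have := @largest_pq_bad _ x_nint b y b0; rewrite form_truncation Ea.
rewrite mulf_neq0 ?intr_eq0 // ?invr_eq0 ?gt_eqF // => /(_ isT).
rewrite normrM (gtr0_norm (_ : 0 < p%:R ^- m)) ?invr_gt0 // !mulrA.
rewrite ler_pdivlMr // mul1r pXE -!intr_norm -[2]/(2%:~R) -intrD -!intrM ler_int.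
move=> /le_trans; apply; rewrite -mulrA normrM [`|b| * _]mulrC ler_wpM2r //.
have := largest_pq_ge1 _ x_nint; lia.
Qed.

Hypothesis xi_irrational : forall q : rat, xi <> ratr q.

Lemma padic_intr_eq0 (z : int) : ((z%:~R : padic p) == 0) = (z == 0).
Proof.
apply/eqP/eqP => [z0|->//]; apply/eqP; rewrite -(intr_eq0 rat) -(padic_norm_eq0 p).
have := padic_abs_int R p z; rewrite z0 -[0]/(0%:~R) padic_abs_int => /eqP.
by rewrite (inj_eq (fmorph_inj _)) padic_norm0 eq_sym.
Qed.

Lemma padic_lin_neq0 (a b : int) : b != 0 -> b%:~R * xi - a%:~R != 0.
Proof.
move=> b0; rewrite subr_eq0; apply/eqP => E.
apply: (xi_irrational (a%:~R / b%:~R)); set q : rat := _ / _.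
have Eq : numq q * b = a * denq q.
  apply: (@intr_inj rat); rewrite !rmorphM /= numqE /q mulrAC divfK // intr_eq0 //.
have b0' : (b%:~R : padic p) != 0 by rewrite padic_intr_eq0.
have d0 : ((denq q)%:~R : padic p) != 0 by rewrite padic_intr_eq0 denq_eq0.
apply: (mulfI b0'); rewrite E /ratr; apply: (mulIf d0).
by rewrite mulrA divfK // -!intrM -Eq mulrC.
Qed.

(** If [x_m] is an integer, then [p^m] divides [S_m] and so [|xi|_p <= p^-m] (the pair [a = 0],
    [b = 1]). As [xi] is nonzero, this bounds [m]. *)
Lemma truncation_nint : exists m0, forall m, (m0 <= m)%N ->
  padic_truncation p c m \isn't a Num.int.
Proof.
have xi0 : 0 < N xi.
  apply: padic_abs_gt0; have := padic_lin_neq0 0 1 isT.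
  by rewrite mul1r subr0.
exists (Num.bound (N xi)^-1) => m m0m; apply/negP => /intrP[z Ez].
have := @padic_abs_approx R p p_prime c xi xi_sum 0 1 m.
rewrite mul1r subr0 mul1r subr0.
have -> : S m = z * (p ^ m)%N%:Z.
  apply: (@intr_inj rat); rewrite rmorphM /= -pXE -Ez padic_truncationE //.
  by rewrite divfK // gt_eqF.
rewrite dvdz_mull // leNgt => /negP; apply.
rewrite -[ltRHS]invrK ltf_pV2 ?posrE ?invr_gt0 ?exprn_gt0 ?ltr0n ?prime_gt0 //.
apply: (lt_le_trans (archi_boundP _)); first by rewrite invr_ge0 ltW.
rewrite -natrX ler_nat; apply: leq_trans m0m _.
by apply: ltnW; apply: ltn_expl; apply: prime_gt1.
Qed.

Variable B : int.
Hypothesis c_le : forall k, c k <= B.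
Hypothesis B_ge0 : 0 <= B.

(** Induction using [p >= 2]: the new term is at most [B p^m], and [2 B p^m <= B p^(m+1)]. *)
Lemma partial_sum_le m : S m <= B * (p ^ m)%N%:Z.
Proof.
elim: m => [|m IH]; first by rewrite /partial_sum big_ord0 mulr1.
rewrite /partial_sum big_ord_recr /=.
have p2 : 2 <= (p%:Z : int) by rewrite lez_nat prime_gt1.
apply: (@le_trans _ _ (B * (p ^ m)%N%:Z + B * (p ^ m)%N%:Z)).
  by rewrite lerD // ler_wpM2r.
rewrite -mulrDr ler_wpM2l // expnS PoszM -mulr2n -mulr_natl ler_wpM2r //.
Qed.

Lemma padic_truncation_le m : padic_truncation p c m <= B%:~R.
Proof.
rewrite padic_truncationE // ler_pdivrMr // pXE -intrM ler_int.
exact: partial_sum_le.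
Qed.

(** Take [a = b S_m - y p^m] for the pair [(b, y)] of [largest_pq_good] with [K = B + 1], which
    bounds [x_m] and is at least 1. *)
Lemma approximation_exists m : padic_truncation p c m \isn't a Num.int ->
  exists a b : int, [/\ a * b != 0, N (b%:~R * xi - a%:~R) <= p%:R ^- m &
    `|a * b| * M m <= (B + 1) * (p ^ m)%N%:Z].
Proof.
move=> x_nint; have xB : padic_truncation p c m <= (B + 1)%:~R.
  by rewrite (le_trans (padic_truncation_le m)) // ler_int lerDl.
have B1 : 1 <= (B + 1)%:~R :> rat by rewrite -[leLHS]/(1%:~R) ler_int lerDr.
have [b [y [b0]]] := largest_pq_good _ x_nint _ B1 xB.
rewrite form_truncation; set a := b * S m - y * _ => w0 h.
exists a, b; split.
- apply: mulf_neq0; last by rewrite gt_eqF.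
  by apply: contraNneq w0 => ->; rewrite mul0r.
- rewrite (padic_abs_approx _ _ p_prime _ _ xi_sum) /a opprB addrC subrK.
  exact: dvdz_mull.
- rewrite -(ler_int rat) rmorphM [leRHS]rmorphM /= -pXE -ler_pdivrMr //.
  apply: le_trans h; rewrite le_eqVlt; apply/orP; left; apply/eqP.
  rewrite normrM (gtr0_norm b0) rmorphM normrM.
  rewrite (gtr0_norm (_ : 0 < p%:R ^- m)) ?invr_gt0 //.
  by rewrite -intr_norm; ring.
Qed.

End Approximations.

(** * Exponents *)

Section LogHeight.
Variable R : realType.
Implicit Types a b : int.

(** For nonzero [a b], twice the logarithm of [mult_height]; in this scale the conditions on
    exponents become linear inequalities. *)
Definition log_height a b : R := ln `|(a * b)%:~R|.

Lemma log_height_ge0 a b : a * b != 0 -> 0 <= log_height a b.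
Proof. by move=> ab0; apply/ln_ge0/intr_norm_ge1. Qed.

Lemma mult_height_gt0 a b : (0 < mult_height R a b) = (a * b != 0).
Proof. by rewrite /mult_height sqrtr_gt0 normr_gt0 intr_eq0. Qed.

Lemma mult_heightE a b : a * b != 0 -> mult_height R a b = expR (log_height a b / 2).
Proof.
move=> ab0; have n0 : 0 < `|(a * b)%:~R : R| by rewrite normr_gt0 intr_eq0.
rewrite /mult_height -powR12_sqrt ?ltW // /powR gt_eqF //.
by rewrite mulrC.
Qed.

Lemma mult_height_powR a b (mu : R) : a * b != 0 ->
  mult_height R a b `^ mu = expR (mu / 2 * log_height a b).
Proof.
move=> ab0; rewrite /powR gt_eqF ?mult_height_gt0 // mult_heightE // expRK.
by congr expR; ring.
Qed.

(** Both factors are nonzero integers, so each is bounded by the absolute value of the product. *)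
Lemma finite_log_height (C : R) :
  finite_set [set ab : int * int | ab.1 * ab.2 != 0 /\ log_height ab.1 ab.2 <= C].
Proof.
have [n hn] : exists n : nat, expR C <= n%:R.
  by exists (Num.bound (expR C)); rewrite ltW // archi_boundP // expR_ge0.
have fin_int : finite_set [set z : int | `|z| <= n%:Z].
  apply: (sub_finite_set _ (finite_image (fun k : nat => k%:Z - n%:Z)
    (finite_II (2 * n).+1))).
  by move=> z /= zn; exists (absz (z + n%:Z)); rewrite /=; lia.
apply: sub_finite_set (finite_setX fin_int fin_int) => -[a b] /= [ab0 hab].
have : `|a * b| <= n%:Z.
  rewrite -(ler_int R) intr_norm (le_trans _ hn) // -ler_ln ?posrE ?expR_gt0 //.
    by rewrite expRK.
  by rewrite normr_gt0 intr_eq0.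
move: ab0; rewrite mulf_eq0 negb_or normrM => /andP[a0 b0] h.
have a1 : 1 <= `|a| by rewrite -gtz0_ge1 normr_gt0.
have b1 : 1 <= `|b| by rewrite -gtz0_ge1 normr_gt0.
by split; nia.
Qed.

End LogHeight.

(** * Both exponents from two-sided bounds on the least [log_height] at each level [m] *)

Section Exponents.
Variables (R : realType) (p : nat) (xi : padic p) (h : nat -> R) (k : R).
Hypothesis p_prime : prime p.
Hypothesis xi_irrational : forall q : rat, xi <> ratr q.
Local Notation N := (@padic_abs p R).
Local Notation L := (log_height R).
Local Notation l := (ln p%:R : R).

Variable m0 : nat.
Hypothesis good : forall m, (m0 <= m)%N -> exists a b : int,
  [/\ a * b != 0, N (b%:~R * xi - a%:~R) <= p%:R ^- m &
      L a b <= k + m%:R * l * (1 - h m)].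
Hypothesis bad : forall m, (m0 <= m)%N -> forall a b : int, a * b != 0 ->
  N (b%:~R * xi - a%:~R) <= p%:R ^- m -> m%:R * l * (1 - h m) <= k + L a b.

Let l_gt0 : 0 < l. Proof. by rewrite ln_gt0 // ltr1n prime_gt1. Qed.

Let pXE m : p%:R ^- m = expR (- (m%:R * l)) :> R.
Proof.
rewrite expRN; congr (_^-1); rewrite mulrC mulr_natr -lnXn ?lnK //.
  by rewrite posrE exprn_gt0 // ltr0n prime_gt0.
by rewrite ltr0n prime_gt0.
Qed.

Let lt_exponent (mu t : R) : 0 < mu -> mu * (1 - t) < 2 ->
  exists2 e, e < t & mu * (1 - e) < 2.
Proof.
(* This makes [mu (1 - e)] the midpoint of [mu (1 - t)] and 2. *)
move=> mu0 ht; exists (t - (2 - mu * (1 - t)) / (2 * mu)).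
  by rewrite ltrBlDr ltrDl divr_gt0 ?mulr_gt0 // subr_gt0.
rewrite opprB addrCA addrC mulrDr mulrCA invfM [mu * (_^-1 * _)]mulrCA divff ?gt_eqF //.
by lra.
Qed.

Let gt_exponent (mu t : R) : 0 < mu -> 2 < mu * (1 - t) ->
  exists2 e, t < e & 2 < mu * (1 - e).
Proof.
move=> mu0 ht; exists (t + (mu * (1 - t) - 2) / (2 * mu)).
  by rewrite ltrDl divr_gt0 ?mulr_gt0 // subr_gt0.
rewrite opprD addrA mulrBr mulrCA invfM [mu * (_^-1 * _)]mulrCA divff ?gt_eqF //.
by lra.
Qed.

(** The pairs given by [good] at levels where [h m] is near its upper limit solve the inequality for
    [mu] when [mu (1 - t) < 2]. Conversely, a solution for [mu] is an approximation at a level about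
    [mu L / (2 l)], to which [bad] applies. *)
Lemma mult_exponentE (t : R) : limn_esup (fun m => (h m)%:E) = t%:E -> t <= 1 ->
  mult_exponent R xi = (2%:E / (1%:E - t%:E))%E.
Proof.
move=> ht t1; apply: ereal_sup_exponent => // mu mu0.
  move=> /(lt_exponent _ _ mu0)[e et mue] A_fin.
  set A := [set ab | _] in A_fin.
  (* On a finite solution set [|b xi - a|_p] has a positive lower bound; the initial value 1 of the
     minimum covers the empty set. *)
  have [r r0 hr] : exists2 r : R, 0 < r &
      forall ab, A ab -> r <= N (ab.2%:~R * xi - ab.1%:~R).
    have /finite_seqP[s As] := A_fin.
    exists (\big[Num.min/1]_(ab <- s | `[< A ab >]) N (ab.2%:~R * xi - ab.1%:~R)).
      apply: (big_ind (fun z : R => 0 < z)) => // [x y x0 y0|ab /asboolP[]//].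
      by rewrite lt_min x0.
    move=> ab Aab; have abs : ab \in s by move: (Aab); rewrite As.
    apply: (@ge_bigmin_seq _ _ _ s 1 ab (fun ab => `[< A ab >])
      (fun ab => N (ab.2%:~R * xi - ab.1%:~R))) => //.
    exact/asboolP.
  (* From [n1] on, [mu / 2 * (k + m l (1 - e)) < m l], which makes the pair a solution; from [n2]
     on, [p^-m < r]. *)
  have [n1 hn1] := @natr_mul_large R (l * (1 - mu * (1 - e) / 2)) (k * mu / 2)
    ltac:(by apply: mulr_gt0 => //; lra).
  have [n2 hn2] := @natr_mul_large R l (- ln r) l_gt0.
  have := @lt_limn_esup R (fun m => (h m)%:E) e%:E.
  rewrite ht lte_fin => /(_ et (maxn m0 (maxn n1 n2)))[m].
  rewrite !geq_max lte_fin => /and3P[m0m n1m n2m] em.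
  have [a [b [ab0 Nab Lab]]] := good _ m0m.
  have b0 : b != 0 by apply: contraNneq ab0 => ->; rewrite mulr0.
  have a0 : a != 0 by apply: contraNneq ab0 => ->; rewrite mul0r.
  have : r <= N (b%:~R * xi - a%:~R).
    apply: (hr (a, b)); split=> //=.
      exact/padic_abs_gt0/padic_lin_neq0.
    apply: le_trans Nab _; rewrite mult_height_powR // pXE ler_expR.
    have := hn1 _ n1m.
    have : L a b <= k + m%:R * l * (1 - e).
      apply: le_trans Lab _; rewrite lerD2l ler_wpM2l ?lerB ?(ltW em) //.
      by rewrite mulr_ge0 // ltW.
    rewrite -(ler_pM2l mu0); lra.
  move=> /le_trans/(_ Nab); rewrite pXE -[r]lnK // ler_expR.
  by have := hn2 _ n2m; lra.
move=> A_inf; rewrite leNgt; apply/negP => /(gt_exponent _ _ mu0)[e te mue].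
have := @limn_esup_lt R (fun m => (h m)%:E) e%:E.
rewrite ht lte_fin => /(_ te)[n1 hn1].
have [n2 hn2] := @natr_mul_large R (l * (mu * (1 - e) / 2 - 1)) (k * mu / 2 + l)
    ltac:(by apply: mulr_gt0 => //; lra).
apply: A_inf; pose m1 := maxn m0 (maxn n1 n2).
apply: sub_finite_set (finite_log_height R (2 / mu * ((m1.+1)%:R * l))).
move=> -[a b] /= [a0 b0 N0 Nab]; have ab0 : a * b != 0 by rewrite mulf_neq0.
split=> //; rewrite leNgt; apply/negP => m1L.
(* The largest level with [mult_height^-mu <= p^-m], whence [L < 2 (m + 1) l / mu]; this rounding
   explains the extra [l] in the choice of [n2]. *)
pose m := Num.truncn (mu / 2 * L a b / l).
have muL0 : 0 <= mu / 2 * L a b / l.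
  by rewrite divr_ge0 ?mulr_ge0 ?log_height_ge0 ?invr_ge0 // ltW.
have /andP[mL Lm] := truncn_itv muL0.
move: mL Lm; rewrite -/m ler_pdivlMr // ltr_pdivrMr // => mL Lm.
have m1m : (m1 <= m)%N.
  rewrite -ltnS -(ltr_nat R) -(ltr_pM2r l_gt0); apply: lt_trans Lm.
  apply: (@le_lt_trans _ _ (mu / 2 * (2 / mu * (m1.+1%:R * l)))).
    rewrite mulrA mulf_div [mu * 2]mulrC divff; last by rewrite gt_eqF // mulr_gt0.
    by rewrite mul1r ler_wpM2r ?ler_nat // ltW.
  by rewrite ltr_pM2l // divr_gt0.
move: (m1m); rewrite !geq_max => /and3P[m0m n1m n2m].
have Nm : N (b%:~R * xi - a%:~R) <= p%:R ^- m.
  apply: le_trans Nab _; rewrite mult_height_powR // pXE ler_expR.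
  by move: mL; rewrite mulNr mulNr lerN2.
have := bad _ m0m _ _ ab0 Nm.
have hme : m%:R * l * (1 - e) <= m%:R * l * (1 - h m).
  rewrite ler_wpM2l ?mulr_ge0 ?(ltW l_gt0) // lerB // ltW //.
  by have := hn1 _ n1m; rewrite lte_fin.
move=> /(le_trans hme); rewrite -(ler_pM2l mu0).
have := hn2 _ n2m; move: Lm; rewrite -[m.+1%:R]natr1.
by lra.
Qed.

(** The level is now dictated by [X], with [p^-m] close to [X^-mu]. Since every large [X] must be
    served, every large [m] occurs, hence the lower limit. *)
Lemma unif_mult_exponentE (t : R) : limn_einf (fun m => (h m)%:E) = t%:E -> t <= 1 ->
  unif_mult_exponent R xi = (2%:E / (1%:E - t%:E))%E.
Proof.
move=> ht t1; apply: ereal_sup_exponent => // mu mu0.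
  move=> /(lt_exponent _ _ mu0)[e et mue].
  have := @lt_limn_einf R (fun m => (h m)%:E) e%:E.
  rewrite ht lte_fin => /(_ et)[n1 hn1].
  pose m1 := maxn m0 n1.
  near=> X.
  have X0 : 0 < X by near: X; exact: nbhs_pinfty_gt.
  have lnX_ge C : expR C < X -> C < ln X.
    by move=> CX; rewrite -(ltr_expR) lnK.
  (* The three lower bounds on [ln X] serve for [m >= m1], for [mult_height <= X] and for the sign
     of the argument of [truncn]. *)
  have x1 : m1%:R * l / mu < ln X by apply: lnX_ge; near: X; exact: nbhs_pinfty_gt.
  have x2 : (k + (1 - e) * l) / (2 - mu * (1 - e)) < ln X.
    by apply: lnX_ge; near: X; exact: nbhs_pinfty_gt.
  have x3 : 0 < ln X by apply: lnX_ge; near: X; exact: nbhs_pinfty_gt.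
  have /truncn_itv/andP[] : 0 <= mu * ln X / l by rewrite divr_ge0 ?mulr_ge0 // ltW.
  (* The level [m = n + 1] is the least one with [p^-m < X^-mu]; rounding up costs at most
     [l (1 - e)] in the height, as allowed for by [x2]. *)
  move: (Num.truncn _) => n; rewrite ler_pdivlMr // ltr_pdivrMr // => nX.
  rewrite -natr1; move En : n.+1 => m; rewrite natr1 En => Xm.
  have : (m1 <= m)%N.
    rewrite -(ler_nat R) -(ler_pM2r l_gt0); apply: ltW (lt_trans _ Xm).
    by rewrite [ltRHS]mulrC -ltr_pdivrMr.
  rewrite geq_max => /andP[m0m n1m].
  have [a [b [ab0 Nab Lab]]] := good _ m0m.
  have {}Lab : L a b <= k + m%:R * l * (1 - e).
    apply: le_trans Lab _; rewrite lerD2l ler_wpM2l ?mulr_ge0 ?(ltW l_gt0) //.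
    by rewrite lerB // ltW //; have := hn1 _ n1m; rewrite lte_fin.
  exists a, b; split; first by rewrite mult_height_gt0.
    rewrite mult_heightE // -[leRHS]lnK ?posrE // ler_expR ler_pdivrMr //.
    apply: le_trans Lab _; move: x2; rewrite ltr_pdivrMr ?subr_gt0 // => x2.
    have e1 : 0 <= 1 - e by rewrite subr_ge0 (le_trans (ltW et)).
    have := ler_wpM2r e1 nX; rewrite -En -[n.+1%:R]natr1; lra.
  apply: le_trans Nab _; rewrite pXE /powR gt_eqF // ler_expR mulNr lerN2.
  exact: ltW.
move=> hX; rewrite leNgt; apply/negP => /(gt_exponent _ _ mu0)[e te mue].
have [A [_ hA]] := hX.
have [n1 hn1] := @natr_mul_large R (l * (mu * (1 - e) - 2)) (k * mu)
    ltac:(by apply: mulr_gt0 => //; lra).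
(* From [n2] on, [p^(m / mu)] exceeds the threshold [A]; the maximum with 1 is positive, hence the
   exponential of its logarithm. *)
have [n2 hn2] := @natr_mul_large R (l / mu) (ln (Num.max A 1))
    ltac:(by rewrite divr_gt0).
have := @limn_einf_lt R (fun m => (h m)%:E) e%:E.
rewrite ht lte_fin => /(_ te (maxn m0 (maxn n1 n2)))[m].
rewrite !geq_max lte_fin => /and3P[m0m n1m n2m] em.
(* For this [X], the bound [X^-mu] is exactly [p^-m], so [bad] applies at level [m]. *)
have [] := hA (expR (m%:R * l / mu)).
  apply: (@le_lt_trans _ _ (Num.max A 1)); first by rewrite le_max lexx.
  rewrite -[ltLHS]lnK ?posrE ?lt_max ?ltr01 ?orbT // ltr_expR -mulrA.
  exact: hn2.
move=> a [b []]; rewrite mult_height_gt0 => ab0.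
rewrite mult_heightE // ler_expR => Lab.
rewrite /powR gt_eqF ?expR_gt0 // expRK mulNr [mu * _]mulrC divfK ?gt_eqF // -pXE => Nab.
have := bad _ m0m _ _ ab0 Nab.
have hme : m%:R * l * (1 - e) <= m%:R * l * (1 - h m).
  by rewrite ler_wpM2l ?mulr_ge0 ?(ltW l_gt0) // lerB // ltW.
move=> /(le_trans hme); rewrite -(ler_pM2l mu0).
move: Lab; rewrite ler_pdivlMr // => Lab.
have := hn1 _ n1m; move: Lab.
by lra.
Unshelve. all: by end_near. Qed.

End Exponents.

(** * Logarithmic form of [eta_seq] and range of its limits *)

Section EtaSeq.
Variables (R : realType) (p : nat) (c : nat -> int).
Hypothesis p_prime : prime p.
Local Notation M m := (largest_partial_quotient (padic_truncation p c m)).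

(** The set in [eta_seq] is inhabited here, so [xget] does not return its default 0. *)
Lemma eta_seqE m : (0 < m)%N -> 0 < M m ->
  m%:R * ln p%:R * eta_seq R p c m = ln (M m)%:~R.
Proof.
move=> m0 M0; have p0 : (0 : R) < p%:R by rewrite ltr0n prime_gt0.
have lp : 0 < ln (p%:R : R) by rewrite ln_gt0 // ltr1n prime_gt1.
have m0' : (0 : R) < m%:R by rewrite ltr0n.
rewrite /eta_seq; case: xgetP => [e _ /= ->|/(_ (ln (M m)%:~R / ln p%:R / m%:R))] /=.
  by rewrite ln_powR; ring.
case; rewrite divfK ?gt_eqF // /powR gt_eqF // divfK ?gt_eqF //.
by rewrite lnK // posrE ltr0z.
Qed.

End EtaSeq.

Section LimnBounds.
Variables (R : realType) (h : nat -> R) (k l : R) (m0 : nat).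
Hypothesis l_gt0 : 0 < l.
Hypothesis h_ge0 : forall m, (m0 <= m)%N -> 0 <= h m.
Hypothesis h_le : forall m, (m0 <= m)%N -> m%:R * l * (h m - 1) <= k.
Local Open Scope ereal_scope.

Lemma limn_esup_le1 : limn_esup (fun m => (h m)%:E) <= 1%:E.
Proof.
apply/lee_addgt0Pr => e e0; rewrite leNgt; apply/negP => h1.
have [n1 hn1] := @natr_mul_large R (l * e)%R k (mulr_gt0 l_gt0 e0).
have [m] := lt_limn_esup _ _ _ h1 (maxn m0 n1).
rewrite geq_max => /andP[m0m n1m]; rewrite -EFinD lte_fin => hm.
have := hn1 _ n1m; apply/negP; rewrite -leNgt (le_trans _ (h_le _ m0m)) // mulrA.
by rewrite ler_wpM2l ?mulr_ge0 ?(ltW l_gt0) //; lra.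
Qed.

Lemma limn_einf_ge0 : 0 <= limn_einf (fun m => (h m)%:E).
Proof.
rewrite leNgt; apply/negP => /limn_einf_lt/(_ m0)[m /h_ge0 hm].
by rewrite lte_fin ltNge hm.
Qed.

End LimnBounds.

Local Open Scope ereal_scope.

Theorem theorem3p4 (R : realType) (p : nat) (c : nat -> int) (xi : padic p)
  (p_prime : prime p)
  (c_bounded : exists B : int, forall k : nat, (`|c k| <= B)%R)
  (xi_sum : is_padic_series_sum R c xi)
  (xi_irrational : forall q : rat, xi <> (ratr q)%R) :
  mult_exponent R xi = 2%:E / (1%:E - eta R p c) /\
  unif_mult_exponent R xi = 2%:E / (1%:E - eta_hat R p c).
Proof.
have [B cB] := c_bounded.
have c_le k : (c k <= B)%R by rewrite (le_trans (ler_norm _)).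
have B0 : (0 <= B)%R by rewrite (le_trans (normr_ge0 (c 0%N))).
have [m1 nint] := truncation_nint _ _ _ _ p_prime xi_sum xi_irrational.
(* From [m0] on, [x_m] is not an integer and [m > 0], as [eta_seqE] requires. *)
pose m0 := maxn m1 1; pose h := eta_seq R p c.
(* [B + 3] dominates both the [B + 1] of [approximation_exists] and the 3 of
   [approximation_bound]. *)
pose l : R := ln p%:R; pose k : R := ln ((B + 3)%:~R).
have l0 : (0 < l)%R by rewrite ln_gt0 // ltr1n prime_gt1.
have lnpX m : ln ((p ^ m)%N%:Z%:~R : R) = (m%:R * l)%R.
  by rewrite -pmulrn natrX lnXn ?ltr0n ?prime_gt0 // [RHS]mulr_natl.
pose M m := largest_partial_quotient (padic_truncation p c m).
have hE m : (m0 <= m)%N -> (1 <= M m)%R /\ (m%:R * l * h m)%R = ln ((M m)%:~R : R).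
  rewrite geq_max => /andP[m1m m_gt0].
  have M1 : (1 <= M m)%R := largest_pq_ge1 _ (nint _ m1m).
  split=> //; apply: (eta_seqE _ _ _ p_prime m m_gt0).
  by rewrite (lt_le_trans _ M1).
have int_pos (z : int) : (0 < z)%R -> ((z%:~R : R) \is Num.pos)%R by rewrite posrE ltr0z.
have B3 : (0 < B + 3)%R by lia.
have pX_gt0 m : (0 < (p ^ m)%N%:Z)%R by rewrite ltz_nat expn_gt0 prime_gt0.
have good m : (m0 <= m)%N -> exists a b : int,
    [/\ a * b != 0, padic_abs R (b%:~R * xi - a%:~R) <= p%:R ^- m &
      log_height R a b <= k + m%:R * l * (1 - h m)]%R.
  move=> m0m; have [M1 hm] := hE _ m0m.
  have M0 : (0 < M m)%R := lt_le_trans ltr01 M1.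
  have /nint x_nint : (m1 <= m)%N by apply: leq_trans m0m; apply: leq_maxl.
  have [a [b [ab0 Nab hab]]] :=
    approximation_exists _ _ _ _ p_prime xi_sum _ c_le B0 _ x_nint.
  exists a, b; split=> //; rewrite mulrBr mulr1 hm addrA lerBrDr -lnpX.
  have ab1 : (0 < `|a * b|)%R by rewrite normr_gt0.
  rewrite /log_height -intr_norm -!lnM ?int_pos //.
  rewrite -!intrM ler_ln ?int_pos ?mulr_gt0 //.
  rewrite ler_int (le_trans hab) // ler_wpM2r //; lia.
have bad m : (m0 <= m)%N -> forall a b : int, (a * b != 0)%R ->
    (padic_abs R (b%:~R * xi - a%:~R) <= p%:R ^- m)%R ->
    (m%:R * l * (1 - h m) <= k + log_height R a b)%R.
  move=> m0m a b ab0 Nab; have [M1 hm] := hE _ m0m.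
  have M0 : (0 < M m)%R := lt_le_trans ltr01 M1.
  have /nint x_nint : (m1 <= m)%N by apply: leq_trans m0m; apply: leq_maxl.
  have := approximation_bound _ _ _ _ p_prime xi_sum _ _ _ x_nint ab0 Nab.
  rewrite mulrBr mulr1 hm lerBlDr -lnpX => hab.
  have ab1 : (0 < `|a * b|)%R by rewrite normr_gt0.
  rewrite /log_height -intr_norm addrAC -!lnM ?int_pos //; last first.
    by rewrite -intrM int_pos // mulr_gt0.
  rewrite -!intrM ler_ln ?int_pos ?mulr_gt0 //.
  by rewrite ler_int (le_trans hab) // -!mulrA ler_wpM2r ?lerDr // mulr_ge0 // ltW.
have h_ge0 m : (m0 <= m)%N -> (0 <= h m)%R.
  move=> m0m; have [M1 hm] := hE _ m0m.
  have m_gt0 : (0 < m%:R * l)%R.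
    by rewrite mulr_gt0 // ltr0n; apply: leq_trans m0m; apply: leq_maxr.
  by rewrite -(pmulr_rge0 _ m_gt0) hm ln_ge0 // -[leLHS]/(1%:~R)%R ler_int.
(* A nonzero integer [a b] has nonnegative [log_height], which bounds [h m] through [good]. *)
have h_le m : (m0 <= m)%N -> (m%:R * l * (h m - 1) <= k)%R.
  move=> /good[a [b [ab0 _]]]; have := log_height_ge0 R _ _ ab0; lra.
have esup1 := limn_esup_le1 _ _ _ _ _ l0 h_le.
have einf0 := limn_einf_ge0 _ _ _ h_ge0.
have infsup := limn_einf_sup (fun m => (h m)%:E).
split; rewrite /eta /eta_hat -/h.
  (* Both limits lie between 0 and 1, which excludes the infinite cases. *)
  case E : (limn_esup _) => [t| |].
  - apply: (mult_exponentE _ _ _ _ _ p_prime xi_irrational _ good bad _ E).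
    by move: esup1; rewrite E lee_fin.
  - by move: esup1; rewrite E.
  - by move: (le_trans einf0 infsup); rewrite E.
case E : (limn_einf _) => [t| |].
- apply: (unif_mult_exponentE _ _ _ _ _ p_prime _ good bad _ E).
  by move: (le_trans infsup esup1); rewrite E lee_fin.
- by move: (le_trans infsup esup1); rewrite E.
- by move: einf0; rewrite E.
Qed.
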